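(* Let $X_n$ be the number of correct guesses in the card guessing game with complete feedback after a single shelf shuffle of $n$ cards. Then, as $n\to\infty$, $$\frac{X_n-\frac34 n}{\sqrt n/4}\;\to\;\mathcal N(0,1)$$ in distribution, where $\mathcal N(0,1)$ is the standard normal distribution.
   Context: Single shelf shuffle: an ordered deck of $n$ cards labelled $1,\dots,n$ (card $1$ on top, card $n$ at the bottom) is given. Cards are drawn one by one from the bottom of the deck (so in the order $n,n-1,\dots,1$) and put on an initially empty pile; each drawn card is placed, independently, at the top or at the bottom of the pile with probability $1/2$ each. The final pile is the shuffled deck. Game: cards are drawn one after the other from the top of the shuffled deck. Before each draw the player guesses the label of the card; afterwards the card is shown (complete feedback). The player uses the following optimal strategy: the first guess is card $1$; as long as neither card $n-1$ nor card $n$ has been shown, the next guess is the label immediately following that of the most recently shown card; once one of the cards $n-1$ or $n$ has been shown, the player guesses the remaining (not yet shown) cards in descending order. $X_n$ denotes the total number of correct guesses. *)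

(* Defs.v *)
From HB Require Import structures.
From mathcomp Require Import all_boot all_order all_algebra.
From mathcomp Require Import all_classical all_reals all_analysis.
From mathcomp Require Import measurable_realfun.

Set Implicit Arguments.
Unset Strict Implicit.
Unset Printing Implicit Defensive.

Import Order.TTheory GRing.Theory Num.Theory.
Import numFieldNormedType.Exports.

Local Open Scope classical_set_scope.
Local Open Scope ring_scope.

(* The labels of the cards are the natural numbers 1, ..., n.  A deck is a    *)
(* sequence of labels listed from top to bottom.  The coin of the card with   *)
(* label i.+1 is the one with index i : 'I_n; true means top of the pile.     *)

Definition place n (top : 'I_n -> bool) (pile : seq nat) (i : 'I_n) : seq nat :=
  if top i then i.+1 :: pile else rcons pile i.+1.

Definition shelf_shuffle n (top : 'I_n -> bool) : seq nat :=
  foldl (place top) [::] (rev (enum 'I_n)).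

(* The list [shown] of the cards seen so far starts with the latest one.      *)
Definition guess n (shown : seq nat) : nat :=
  if shown is c :: _ then
    if (n.-1 \in shown) || (n \in shown)
    then (\max_(1 <= k < n.+1 | k \notin shown) k)%N
    else c.+1
  else 1%N.

Fixpoint correct_from n (shown deck : seq nat) : nat :=
  if deck is c :: deck' then
    ((guess n shown == c) + correct_from n (c :: shown) deck')%N
  else 0%N.

Definition correct_guesses n (deck : seq nat) : nat := correct_from n [::] deck.

Definition mutually_independent d d' (T : measurableType d)
    (T' : measurableType d') (R : realType) (P : probability T R)
    (I : finType) (X : I -> {RV P >-> T'}) : Prop :=
  forall (J : {set I}) (A : I -> set T'), (forall i, measurable (A i)) ->
    P (\bigcap_(i in [set` J]) (X i @^-1` A i)) =
    (\prod_(i in J) P (X i @^-1` A i))%E.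

Definition fair_coins d (T : measurableType d) (R : realType)
    (P : probability T R) n (C : 'I_n -> {RV P >-> bool}) : Prop :=
  mutually_independent C /\
  forall i, P (C i @^-1` [set true]) = (2^-1)%:E.

Definition num_correct d (T : measurableType d) (R : realType) n
    (C : 'I_n -> {mfun T >-> bool}) : T -> R :=
  fun w => (correct_guesses n (shelf_shuffle (fun i => C i w)))%:R.

Arguments num_correct {d T} R {n} C _.

Definition standardize d (T : measurableType d) (R : realType)
    (X : {mfun T >-> R}) (a b : R) : T -> R :=
  fun w => (X w - a) / b.

Section measurability.
Context d (T : measurableType d) (R : realType).

Lemma measurable_num_correct n (C : 'I_n -> {mfun T >-> bool}) :
  measurable_fun setT (num_correct R C : T -> R).
Proof.
move=> _ Y _; rewrite setTI.
pose g (s : {ffun 'I_n -> bool}) : R :=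
  (correct_guesses n (shelf_shuffle s))%:R.
have -> : num_correct R C @^-1` Y =
    \bigcup_(s in [set s | Y (g s)]) \bigcap_(i : 'I_n) C i @^-1` [set s i].
  apply/seteqP; split=> [w Yw|w [s /= Ys ws]].
    exists [ffun i => C i w]; last by move=> i _; rewrite /= ffunE.
    rewrite /= /g (_ : fun_of_fin _ = fun i => C i w) //.
    by apply/funext => i; rewrite ffunE.
  rewrite /= /num_correct (_ : (fun i => C i w) = s) //.
  by apply/funext => i; exact: ws.
apply: fin_bigcup_measurable => [|s _]; first exact: finite_finset.
apply: fin_bigcap_measurable => [|i _]; first exact: finite_finset.
by rewrite -[X in measurable X]setTI; exact: measurable_funP.
Qed.

HB.instance Definition _ n (C : 'I_n -> {mfun T >-> bool}) :=
  isMeasurableFun.Build _ _ _ _ (num_correct R C) (measurable_num_correct C).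

Lemma measurable_standardize (X : {mfun T >-> R}) (a b : R) :
  measurable_fun setT (standardize X a b).
Proof.
by apply: measurable_funM => //; apply: measurable_funB => //; exact: measurable_funP.
Qed.

HB.instance Definition _ (X : {mfun T >-> R}) (a b : R) :=
  isMeasurableFun.Build _ _ _ _ (standardize X a b)
    (measurable_standardize X a b).

End measurability.

(* The variables may live on different probability spaces.                    *)
Definition cvg_in_distribution (R : realType) (d : nat -> measure_display)
    (T : forall n, measurableType (d n)) (P : forall n, probability (T n) R)
    (X : forall n, {RV (P n) >-> R})
    (mu : probability (measurableTypeR R) R) : Prop :=
  forall x : R, {for x, continuous (fun y : R => mu `]-oo, y]%classic)} ->
    cdf (X n) x @[n --> \oo] --> mu `]-oo, x]%classic.
Arguments cvg_in_distribution {R d T} P X mu.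

(* Main.v *)
(* Let t_0 = true and let t_k be the coin of card k.  The shuffled deck is the
   increasing list of the top cards followed by the decreasing list of the
   bottom cards, so the guesses of the first phase are correct exactly when
   t_k = t_(k+1) = true and, apart from the first of n - 1 and n to be shown,
   every card of the second phase is guessed.  This gives
   2 X_n = n + t_(n-1) + #{k < n - 1 | t_k = t_(k+1)}, and the n - 1 agreements
   are again independent fair coins.  Up to a bounded error, X_n is thus governed
   by a binomial variable with parameters 2m and 1/2, m = (n - 1) / 2.

   For the central limit theorem, C(2m, m + j) / C(2m, m) lies between
   exp (- j^2 / (m - j + 1)) and exp (- j^2 / (m + j)).  The step function taking
   this value on [j / h, (j + 1) / h[ with h = sqrt (m / 2) then tends to
   exp (- t^2 / 2) and is dominated by a multiple of exp (- t^2 / 8).  Dividing the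
   integral over a half-line by the total integral removes the central binomial
   coefficient, so Stirling's formula is not needed. *)

Require Import Defs.
From mathcomp Require Import all_boot all_order all_algebra.
From mathcomp Require Import all_classical all_reals all_analysis.
From mathcomp Require Import measurable_realfun ring lra zify.
Import Order.TTheory GRing.Theory Num.Theory.
Import numFieldNormedType.Exports.

Set Implicit Arguments.
Unset Strict Implicit.
Unset Printing Implicit Defensive.

(** * The shape of the shuffled deck and the score it yields *)

Lemma shelf_shuffleE n (top : 'I_n -> bool) (t : nat -> bool) :
    (forall i : 'I_n, t i.+1 = top i) ->
  shelf_shuffle top =
    [seq k <- iota 1 n | t k] ++ rev [seq k <- iota 1 n | ~~ t k].
Proof.
move=> ttop; have -> : iota 1 n = [seq (val i).+1 | i <- enum 'I_n].
  by rewrite -(addn0 1) iotaDl -val_enum_ord -map_comp.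
(* The head of the enumeration is drawn last, so it lands outside all cards already on the pile. *)
rewrite /shelf_shuffle; elim: (enum 'I_n) => // i s IHs.
rewrite rev_cons foldl_rcons IHs /place -ttop /=.
by case: (t i.+1) => //=; rewrite rev_cons rcons_cat.
Qed.

Lemma bigmax_eq_mem n (P : pred nat) m :
    0 < m < n.+1 -> P m -> (forall k, 0 < k < n.+1 -> P k -> k <= m) ->
  \max_(1 <= k < n.+1 | P k) k = m.
Proof.
move=> mn Pm ub; apply/eqP; rewrite eqn_leq; apply/andP; split.
  rewrite big_nat_cond; apply/bigmax_leqP_seq => k _; case/andP; exact: ub.
by apply: (@leq_bigmax_seq _ _ _ id) => //; rewrite mem_index_iota.
Qed.

Lemma gtn_trans : transitive gtn.
Proof. by move=> m n p /= mn pm; exact: ltn_trans pm mn. Qed.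

(** The deck consists of the unseen cards in decreasing order, so its first card is their maximum,
    which is the guess of the second phase. Showing it preserves this situation. *)
Lemma correct_from_descending n shown deck :
    shown != [::] -> (n.-1 \in shown) || (n \in shown) ->
    sorted gtn deck ->
    (forall k, (k \in deck) = (0 < k < n.+1) && (k \notin shown)) ->
  correct_from n shown deck = size deck.
Proof.
elim: deck shown => //= c deck IH [//|s0 shown] _ endgame deckS mem_deck.
have c_ub k : k \in deck -> k < c.
  by move=> kd; move/(order_path_min gtn_trans)/allP: deckS; exact.
have /andP[cn c_new] : (0 < c < n.+1) && (c \notin s0 :: shown).
  by rewrite -mem_deck mem_head.
have -> : guess n (s0 :: shown) = c.
  rewrite /guess endgame; apply: bigmax_eq_mem => // k kn k_new.
  have : k \in c :: deck by rewrite mem_deck kn.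
  by rewrite inE => /predU1P[->//|/c_ub/ltnW].
rewrite eqxx IH ?(path_sorted deckS) //.
  by move: endgame; rewrite !(in_cons c) => /orP[] ->; rewrite ?orbT.
move=> k; move: (mem_deck k); rewrite !(in_cons c).
rewrite negb_or andbCA => <-.
by case: eqVneq => //= ->; apply/negP => /c_ub; rewrite ltnn.
Qed.

Lemma sorted_rev_filter_iota (P : pred nat) m n :
  sorted gtn (rev [seq k <- iota m n | P k]).
Proof.
by rewrite rev_sorted; apply: sorted_filter; [exact: ltn_trans|exact: iota_ltn_sorted].
Qed.

Lemma mem_rev_filter_iota1 (P : pred nat) n k :
  (k \in rev [seq k <- iota 1 n | P k]) = (0 < k < n.+1) && P k.
Proof. by rewrite mem_rev mem_filter mem_iota andbC. Qed.

(* The state of the ascending phase when the labels up to [k] are settled: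
   [c] is the label shown last, or 0 if there is none. *)
Lemma correct_from_ascending p (t : nat -> bool) k r shown :
    let c := head 0 shown in
    let D := rev [seq j <- iota 1 p | ~~ t j] in
    t 0 -> k + r.+1 = p ->
    c <= k -> (c == k) = t k ->
    (forall j, (j \in shown) = [&& 0 < j, j <= k & t j]) ->
  correct_from p.+1 shown ([seq j <- iota k.+1 r.+1 | t j] ++ p.+1 :: D) =
    \sum_(k <= i < p) (t i && t i.+1) + size D + t p.
Proof.
move=> c D t0; elim: r k shown @c => [|r IH] k shown c kp ck ctk mem_shown.
  (* All shown labels are at most [k < p], so neither [p] nor [p.+1], the two largest labels, has
     been shown. *)
  have guessE : guess p.+1 shown = c.+1.
    rewrite /guess /c; move: mem_shown; case: (shown) => // a s ms.
    rewrite !ms /=; case: ifP => //.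
    lia.
  have {kp}kp : p = k.+1 by lia.
  have sD : sorted gtn (p.+1 :: D).
    (* [p.+1 :: D] is itself a reversed filtered interval: add [p.+1] to the bottom cards. *)
    move: (sorted_rev_filter_iota (fun j => (j == p.+1) || ~~ t j) 1 (p + 1)).
    rewrite iotaD filter_cat rev_cat add1n /= eqxx /=.
    rewrite (@eq_in_filter _ _ (fun j => ~~ t j)) // => j.
    by rewrite mem_iota => jp; case: eqP => //; lia.
  (* If card [p] is on top, it comes next, is guessed iff [t k] holds, and everything after it is
     guessed. Otherwise [p.+1] comes next and is missed, since the guess [c.+1] is at most [p]; then
     all of [D] is guessed. *)
  rewrite kp big_nat1 /=; rewrite -kp; case: ifP => tp /=.
    rewrite guessE {1}kp eqSS ctk andbT.
    rewrite -/(correct_from p.+1 [:: p & shown] (p.+1 :: D)).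
    rewrite (@correct_from_descending _ _ (p.+1 :: D)) //=.
    - by lia.
    - by rewrite mem_head.
    move=> j; rewrite !inE mem_rev_filter_iota1 mem_shown.
    by case: (eqVneq j p) => [->|]; case: (t j) => /=; rewrite ?tp; lia.
  rewrite guessE andbF.
  rewrite correct_from_descending //=.
  - by lia.
  - by rewrite mem_head orbT.
  - exact: path_sorted sD.
  move=> j; rewrite !inE mem_rev_filter_iota1 mem_shown.
  by case: (eqVneq j p) => [->|]; case: (t j) => /=; rewrite ?tp; lia.
have guessE : guess p.+1 shown = c.+1.
  rewrite /guess /c; move: mem_shown; case: (shown) => // a s ms.
  rewrite !ms /=; case: ifP => //.
  lia.
rewrite big_ltn ?ltnS; last by lia.
have -> : [seq j <- iota k.+1 r.+2 | t j] = if t k.+1 then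
  k.+1 :: [seq j <- iota k.+2 r.+1 | t j] else [seq j <- iota k.+2 r.+1 | t j].
  by [].
case: ifP => tk.
  (* Card [k.+1] is guessed iff the last shown card is [k], that is, iff [t k] holds. *)
  rewrite cat_cons [correct_from _ _ _]/= -/(iota k.+2 r.+1) guessE eqSS ctk andbT.
  rewrite -!addnA; congr (_ + _); rewrite addnA; apply: IH => //=; try lia.
  move=> j; rewrite inE mem_shown.
  by case: (eqVneq j k.+1) => [->|]; rewrite ?tk //; lia.
rewrite andbF add0n; apply: IH => //; try lia.
move=> j; rewrite mem_shown.
case: (eqVneq j k.+1) => [->|]; rewrite ?tk ?andbF //; lia.
Qed.

Definition agreements (t : nat -> bool) p : nat := \sum_(i < p) (t i == t i.+1).

(** By induction on [p]: in all four cases for the coins of [p] and [p.+1], both sides grow by 1 +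
    t_(p+1) - t_p + [t_p = t_(p+1)]. *)
Lemma double_score p (t : nat -> bool) : t 0 ->
  (\sum_(0 <= i < p) (t i && t i.+1) +
    size (rev [seq j <- iota 1 p | ~~ t j]) + t p).*2 =
  p.+1 + t p + agreements t p.
Proof.
move=> t0; rewrite /agreements; elim: p => [|p IH]; first by rewrite big_nil big_ord0 /= t0.
rewrite -{2}(addn1 p) iotaD filter_cat rev_cat size_cat add1n big_nat_recr //= big_ord_recr /=.
by move: IH; case: (t p); case: (t p.+1) => /=; rewrite !size_rev; lia.
Qed.

Lemma correct_guesses_shelf p (top : 'I_p.+1 -> bool) (t : nat -> bool) :
    0 < p -> t 0 -> (forall i : 'I_p.+1, t i.+1 = top i) ->
  (correct_guesses p.+1 (shelf_shuffle top)).*2 = p.+1 + t p + agreements t p.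
Proof.
move=> p0 t0 ttop; rewrite -double_score // (shelf_shuffleE ttop).
(* The largest label sits at the junction of the two runs whichever way its coin falls. *)
have -> : [seq k <- iota 1 p.+1 | t k] ++ rev [seq k <- iota 1 p.+1 | ~~ t k] =
   [seq j <- iota 1 p | t j] ++ p.+1 :: rev [seq j <- iota 1 p | ~~ t j].
  rewrite -(addn1 p) iotaD !filter_cat rev_cat -catA add1n addn1 /=.
  by case: (t p.+1).
case: p p0 t0 {top ttop} => // p _ t0; congr _.*2.
rewrite /correct_guesses (@correct_from_ascending p.+1 t 0 p [::]) //.
by move=> j; rewrite in_nil; lia.
Qed.

Local Open Scope classical_set_scope.
Local Open Scope ring_scope.

(** * Binomial coefficients relative to the central one, and their step functions *)

Section central_binomial.
Variable R : realType.

Definition bin_ratio m k : R := 'C(m.*2, k)%:R / 'C(m.*2, m)%:R.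

Lemma bin_ratio_ge0 m k : 0 <= bin_ratio m k.
Proof. exact: divr_ge0. Qed.

Lemma bin_ratio_center m : bin_ratio m m = 1.
Proof. by rewrite /bin_ratio divff// pnatr_eq0 -lt0n bin_gt0; lia. Qed.

Lemma bin_ratioS m j : (j < m)%N ->
  bin_ratio m (m + j.+1) = bin_ratio m (m + j) * ((m - j)%:R / (m + j).+1%:R).
Proof.
move=> jm; rewrite /bin_ratio mulrAC; congr (_ / _).
apply: (@mulIf _ (m + j).+1%:R); first by rewrite pnatr_eq0.
rewrite mulrA divfK ?pnatr_eq0// -!natrM; congr _%:R.
by rewrite addnS mulnC mul_bin_left mulnC; congr (_ * _)%N; lia.
Qed.

(* The ratio is the product over i <= j of (m - i + 1) / (m + i), whose factors
   lie between exp (- (2i - 1) / (m - J + 1)) and exp (- (2i - 1) / (m + J)). *)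
Lemma bin_ratio_bounds m j : (j <= m)%N ->
  expR (- (j%:R ^+ 2 / (m%:R - j%:R + 1))) <= bin_ratio m (m + j)
     <= expR (- (j%:R ^+ 2 / (m%:R + j%:R))).
Proof.
move=> jm; have : (j <= j)%N by [].
(* Only the running index is generalized; the [j] in the denominators stays fixed, so the exponents
   of successive factors add up. *)
move: {1 3 5 6 7}j => i; elim: i => [_|i IH ij].
  by rewrite addn0 bin_ratio_center expr0n/= !mul0r oppr0 expR0 lexx.
have {IH}/andP[IHl IHu] := IH (ltnW ij).
have im : (i < m)%N by exact: leq_trans ij jm.
have jmR : j%:R <= m%:R :> R by rewrite ler_nat.
have ijR : i%:R + 1 <= j%:R :> R by rewrite natr1 ler_nat.
have i0 : 0 <= i%:R :> R by [].
have sq : i.+1%:R ^+ 2 = i%:R ^+ 2 + (2 * i%:R + 1) :> R by rewrite -natr1; ring.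
have miR : (m - i)%:R = m%:R - i%:R :> R by rewrite natrB // ltnW.
rewrite bin_ratioS // miR sq -[(m + i).+1%:R]natr1 natrD.
rewrite !(mulrDl (i%:R ^+ 2)) !opprD !expRD; apply/andP; split; apply: ler_pM => //;
  rewrite ?expR_ge0 ?bin_ratio_ge0 ?divr_ge0 //; try lra.
  (* The inverse of the new factor is 1 + (2i + 1) / (m - i), and m - j + 1 <= m - i. *)
  rewrite expRN invf_ple ?posrE ?expR_gt0 ?divr_gt0 //; try lra.
  apply: le_trans (expR_ge1Dx _); rewrite invf_div.
  have d0 : 0 < m%:R - i%:R :> R by lra.
  have d1 : 0 < m%:R - j%:R + 1 :> R by lra.
  rewrite ler_pdivrMr // mulrDl mul1r mulrAC -lerBlDl ler_pdivlMr //.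
  rewrite (_ : _ - _ = 2 * i%:R + 1); last by ring.
  by apply: ler_wpM2l; lra.
(* The new factor is 1 - (2i + 1) / (m + i + 1), and m + i + 1 <= m + j. *)
apply: le_trans (expR_ge1Dx _).
have d0 : 0 < m%:R + i%:R + 1 :> R by lra.
have d1 : 0 < m%:R + j%:R :> R by lra.
have : (2 * i%:R + 1) / (m%:R + j%:R) * (m%:R + i%:R + 1) <= 2 * i%:R + 1 :> R.
  by rewrite mulrAC ler_pdivrMr //; apply: ler_wpM2l; lra.
by rewrite ler_pdivrMr // mulrBl mul1r; lra.
Qed.

Lemma bin_ratio_dist m k : (k <= m.*2)%N ->
  bin_ratio m k = bin_ratio m (m + `|k - m|).
Proof.
move=> km; have [mk|/ltnW mk] := leqP m k.
  by rewrite distnEl // subnKC.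
rewrite distnEr // /bin_ratio -bin_sub //.
by congr ('C(_, _)%:R / _); lia.
Qed.

(** The standard deviation of the binomial law with parameters 2m and 1/2. *)
Definition bin_scale m : R := Num.sqrt (m%:R / 2).

Lemma bin_scale_gt0 m : (0 < m)%N -> 0 < bin_scale m.
Proof. by move=> m0; rewrite sqrtr_gt0 divr_gt0 ?ltr0n. Qed.

Lemma sqr_bin_scale m : bin_scale m ^+ 2 = m%:R / 2.
Proof. by rewrite sqr_sqrtr // divr_ge0. Qed.

(** At each [t] at most one term is nonzero; the sum form allows termwise integration. The predicate
    [c] later cuts out a half-line. *)
Definition bin_step (c : pred nat) m (t : R) : R :=
  \sum_(k < m.*2.+1 | c k)
    bin_ratio m k * (Num.floor (t * bin_scale m) == k%:Z - m%:Z)%:R.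

Lemma bin_stepE c m t k : (k <= m.*2)%N ->
    Num.floor (t * bin_scale m) = k%:Z - m%:Z ->
  bin_step c m t = if c k then bin_ratio m k else 0.
Proof.
move=> km tk; rewrite /bin_step big_mkcond/= (bigD1 (Ordinal (km : (k < m.*2.+1)%N)))//=.
rewrite big1 => [|i ik]; first by rewrite tk eqxx mulr1 addr0.
rewrite tk (_ : (_ == _) = false) ?mulr0 ?if_same //.
by apply/negbTE; apply: contra ik => /eqP ik; apply/eqP/val_inj => /=; lia.
Qed.

Lemma bin_step_ge0 c m t : 0 <= bin_step c m t.
Proof. by apply: sumr_ge0 => k _; rewrite mulr_ge0 ?bin_ratio_ge0. Qed.

(** With j the floor of t h, j^2 / (m + |j|) >= j^2 / (2m), while t^2 h^2 <= 2 j^2 + 2 and h^2 = m /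
    2 give t^2 / 8 <= j^2 / (2m) + 1 / (2m). The factor [expR 1] absorbs the last term. *)
Lemma bin_step_le c m t : (0 < m)%N ->
  bin_step c m t <= expR 1 * normal_fun 0 2 t.
Proof.
move=> m0; have rhs_ge0 : 0 <= expR 1 * normal_fun 0 2 t.
  by rewrite mulr_ge0 ?expR_ge0 ?normal_fun_ge0.
set j := Num.floor (t * bin_scale m).
have [jm|jm] := leqP `|j|%N m; last first.
  rewrite /bin_step big1 // => k _; rewrite -/j (_ : (_ == _) = false) ?mulr0 //.
  by have := ltn_ord k; lia.
have [k tk km] : exists2 k : nat, j = k%:Z - m%:Z & (k <= m.*2)%N.
  by exists (absz (j + m%:Z)); lia.
rewrite (bin_stepE c km tk); case: (c k) => //.
have dk : `|k - m|%N = `|j|%N by lia.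
rewrite bin_ratio_dist // dk; have /andP[_ /le_trans ->] // := bin_ratio_bounds jm.
rewrite /normal_fun -expRD ler_expR subr0.
have hm := sqr_bin_scale m; have h0 := bin_scale_gt0 m0.
have m0R : 0 < m%:R :> R by rewrite ltr0n.
have jabs : (`|j|%N%:R : R) ^+ 2 = j%:~R ^+ 2.
  by rewrite natr_absz -rmorphXn /= -normrX ger0_norm ?sqr_ge0 // rmorphXn.
have jmR : `|j|%N%:R <= m%:R :> R by rewrite ler_nat.
have j0R : 0 <= `|j|%N%:R :> R by [].
have m1 : 1 <= m%:R :> R by rewrite ler1n.
have /andP[j1 j2] := floor_itv (t * bin_scale m).
rewrite -/j intrD in j1 j2.
set x : R := `|j|%N%:R in jabs jmR j0R *; set J : R := j%:~R in jabs j1 j2.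
rewrite mulNr lerNl opprD opprK addrC.
have a1 : x ^+ 2 / (2 * m%:R) <= x ^+ 2 / (m%:R + x).
  by rewrite ler_wpM2l ?sqr_ge0 // lef_pV2 ?posrE; lra.
have a2 : (t * bin_scale m) ^+ 2 <= 2 * x ^+ 2 + 2.
  rewrite jabs; set s := t * _ in j1 j2 *; rewrite -subr_ge0.
  (* Both summands are nonnegative because 0 <= s - J < 1. *)
  have -> : 2 * J ^+ 2 + 2 - s ^+ 2 = (2 * J - s) ^+ 2 + 2 * (1 - (s - J)) * (1 + (s - J)).
    by ring.
  by rewrite addr_ge0 ?sqr_ge0 // mulr_ge0; lra.
have u0 : 0 < m%:R^-1 :> R by rewrite invr_gt0.
have u1 : m%:R^-1 <= 1 :> R by rewrite invf_le1.
have := ler_wpM2r (ltW u0) a2; rewrite exprMn hm.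
rewrite (_ : t ^+ 2 * (m%:R / 2) / m%:R = t ^+ 2 / 2); last by field; lra.
by move: a1; rewrite invfM; lra.
Qed.

Definition bin_cell m k : set R :=
  `[(k%:R - m%:R) / bin_scale m, (k%:R - m%:R + 1) / bin_scale m[%classic.

Lemma measurable_bin_cell m k : measurable (bin_cell m k).
Proof. exact: measurable_itv. Qed.

Lemma floor_bin_cell m (m0 : (0 < m)%N) t (k : nat) :
  (Num.floor (t * bin_scale m) == k%:Z - m%:Z)%:R = \1_(bin_cell m k) t :> R.
Proof.
have h0 := bin_scale_gt0 m0.
rewrite indicE; congr ((nat_of_bool _)%:R); rewrite floor_eq.
rewrite /bin_cell; apply/idP/idP; rewrite inE /= in_itv /=.
  by rewrite ler_pdivrMr // ltr_pdivlMr // !intrD intrN.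
by rewrite ler_pdivrMr // ltr_pdivlMr // !intrD intrN.
Qed.

Lemma measurable_bin_step c m : (0 < m)%N ->
  measurable_fun setT (bin_step c m).
Proof.
move=> m0; rewrite (_ : bin_step c m = fun t =>
    \sum_(k < m.*2.+1) if c k then bin_ratio m k * \1_(bin_cell m k) t else 0).
  apply: measurable_sum => k; case: (c k) => //.
  by apply: measurable_funM => //; apply: measurable_indic; exact: measurable_bin_cell.
apply/funext => t; rewrite /bin_step big_mkcond; apply: eq_bigr => k _.
by rewrite floor_bin_cell.
Qed.

Lemma integral_bin_step c m : (0 < m)%N ->
  (\int[lebesgue_measure]_t (bin_step c m t)%:E)%E =
  ((\sum_(k < m.*2.+1 | c k) bin_ratio m k) / bin_scale m)%:E.
Proof.
move=> m0; have h0 := bin_scale_gt0 m0.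
pose I := bin_cell m; have mI := measurable_bin_cell m.
have stepE := floor_bin_cell m0.
pose f k t : \bar R := ((bin_ratio m k)%:E * (\1_(I k) t)%:E)%E.
have muI k : lebesgue_measure (I k) = ((bin_scale m)^-1)%:E.
  rewrite /I /bin_cell lebesgue_measure_itv /= lte_fin.
  rewrite ltr_pM2r ?invr_gt0 // ltrDl ltr01 -EFinB.
  by rewrite -mulrBl addrAC subrr add0r mul1r.
have intI k : (\int[lebesgue_measure]_t (\1_(I k) t)%:E)%E = ((bin_scale m)^-1)%:E.
  rewrite integral_indic //; last exact: mI.
  by rewrite setIT; exact: muI.
have iI k : lebesgue_measure.-integrable setT (fun t => (\1_(I k) t)%:E : \bar R).
  apply/integrableP; split.
    by apply/measurable_EFinP/measurable_indic; exact: mI.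
  under eq_integral do rewrite gee0_abs ?lee_fin//.
  by rewrite [ltLHS](intI k) ltry.
transitivity (\int[lebesgue_measure]_t (\sum_(k < m.*2.+1 | c k) f k t))%E.
  apply: eq_integral => t _; rewrite /bin_step -sumEFin.
  by apply: eq_bigr => k _; rewrite stepE EFinM.
rewrite integral_sum //; last by move=> k; apply: integrableZl => //; exact: iI.
rewrite big_distrl /= -sumEFin; apply: eq_bigr => k _.
rewrite /f integralZl //.
by rewrite [X in (_ * X)%E](intI k) -EFinM.
Qed.

Lemma integrable_bin_step c m : (0 < m)%N ->
  lebesgue_measure.-integrable setT (EFin \o bin_step c m).
Proof.
move=> m0; apply/integrableP; split.
  by apply/measurable_EFinP; exact: measurable_bin_step.
under eq_integral do rewrite /= ger0_norm ?bin_step_ge0//.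
by rewrite [ltLHS](integral_bin_step c m0) ltry.
Qed.

(** * Limits of the step functions and the central limit theorem for even binomials *)

Section step_limit.
Variables (m : nat -> nat) (m_gt0 : forall n, (0 < m n)%N).
Hypothesis m_infty : m @ \oo --> \oo.

Let h n := bin_scale (m n).
Let h_gt0 n : 0 < h n. Proof. exact: bin_scale_gt0. Qed.

Lemma cvg_inv_bin_scale : (h n)^-1 @[n --> \oo] --> (0 : R).
Proof.
apply/(gtr0_cvgV0 (f := h)); first by apply: nearW => n; exact: h_gt0.
apply/cvgryPge => A.
have [k Ak] : exists k : nat, 2 * A ^+ 2 <= k%:R.
  exists (Num.truncn (2 * A ^+ 2)).+1; apply/ltW; exact: truncnS_gt.
have mk : \forall n \near \oo, (k <= m n)%N.
  exact: (m_infty (nbhs_infty_ge k)).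
near=> n.
have [A0|A0] := ltP A 0; first by rewrite (le_trans (ltW A0)) // ltW.
rewrite -(@ler_pXn2r _ 2) ?nnegrE ?(ltW (h_gt0 n)) // sqr_bin_scale.
have : k%:R <= (m n)%:R :> R by rewrite ler_nat; near: n.
lra.
Unshelve. all: by end_near. Qed.

(** With y = |j| / h tending to |t| and v = 1 / h tending to 0, the denominators in
    [bin_ratio_bounds] are h^2 (2 - y v + v^2) and h^2 (2 + y v). Both exponents thus tend to - t^2
    / 2. *)
Lemma cvg_bin_step (c : nat -> pred nat) (b : bool) t :
    (\forall n \near \oo, forall k : nat,
       Num.floor (t * h n) = k%:Z - (m n)%:Z -> c n k = b) ->
  bin_step (c n) (m n) t @[n --> \oo] --> b%:R * normal_fun 0 1 t.
Proof.
move=> cb.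
pose j n := Num.floor (t * h n).
pose x n : R := `|j n|%N%:R.
pose y n : R := x n / h n.
pose v n := (h n)^-1.
have v0 : v n @[n --> \oo] --> 0 by exact: cvg_inv_bin_scale.
have xE n : x n = `|(j n)%:~R| by rewrite /x natr_absz intr_norm.
have yt : y n @[n --> \oo] --> `|t|.
  apply/cvgrPdist_le => e e0; near=> n.
  have ve : v n <= e.
    have : `|0 - v n| <= e by near: n; apply/cvgrPdist_le: e e0.
    by rewrite sub0r normrN gtr0_norm // invr_gt0.
  apply: le_trans ve; rewrite /y xE -[h n in X in _ - X](gtr0_norm (h_gt0 n)).
  rewrite -normf_div; apply: le_trans (ler_dist_dist _ _) _.
  have -> : t - (j n)%:~R / h n = (t * h n - (j n)%:~R) / h n.
    by rewrite mulrBl mulfK // gt_eqF.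
  have /andP[j1 j2] := floor_itv (t * h n).
  rewrite intrD in j2.
  rewrite normf_div (gtr0_norm (h_gt0 n)) ler_pdivrMr // mulVf ?gt_eqF//.
  by rewrite ler_norml; apply/andP; split; rewrite /j; lra.
have limE : - (`|t| ^+ 2 / 2) = - (t - 0) ^+ 2 / (1 ^+ 2 *+ 2).
  by rewrite subr0 expr1n mulNr real_normK // num_real.
have y2 : y n ^+ 2 @[n --> \oo] --> `|t| ^+ 2.
  exact: (cvgM yt yt).
have yv : y n * v n @[n --> \oo] --> 0.
  by rewrite -(mulr0 `|t|); exact: (cvgM yt v0).
have lim2 (d : nat -> R) : d n @[n --> \oo] --> (2 : R) ->
   b%:R * expR (- (y n ^+ 2 / d n)) @[n --> \oo] --> b%:R * normal_fun 0 1 t.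
  move=> d2; apply: cvgM; first exact: cvg_cst.
  rewrite /normal_fun -limE.
  apply: (cvg_comp _ expR); last exact: continuous_expR.
  apply: cvgN; apply: cvgM => //.
  by apply: cvgV => //; rewrite pnatr_eq0.
pose dl n : R := 2 - y n * v n + v n * v n.
pose du n : R := 2 + y n * v n.
apply: (@squeeze_cvgr _ _ _ _ (fun n => b%:R * expR (- (y n ^+ 2 / dl n)))
  (fun n => b%:R * expR (- (y n ^+ 2 / du n)))); last 2 first.
- apply: lim2; rewrite -[X in _ --> X](_ : 2 - 0 + 0 * 0 = _); last by ring.
  by apply: cvgD; [apply: cvgB => //; exact: cvg_cst|exact: cvgM].
- apply: lim2; rewrite -[X in _ --> X](_ : 2 + 0 = _); last by ring.
  by apply: cvgD => //; exact: cvg_cst.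
near=> n.
have hh : h n ^+ 2 = (m n)%:R / 2 by exact: sqr_bin_scale.
have hn0 : h n != 0 by rewrite gt_eqF.
have xy : x n = y n * h n by rewrite /y divfK.
have mh : (m n)%:R = 2 * (h n ^+ 2) by rewrite hh; lra.
(* Eventually y v <= 2, hence |j| = y v h^2 <= 2 h^2 = m. *)
have jm : (`|j n| <= m n)%N.
  rewrite -(ler_nat R) -/(x n) xy mh.
  have yv1 : y n * v n <= 2.
    have : `|0 - y n * v n| <= 2.
      by near: n; move/cvgrPdist_le : yv; apply.
    by rewrite sub0r normrN; apply: le_trans; exact: ler_norm.
  have -> : y n * h n = (y n * v n) * h n ^+ 2.
    by rewrite /v; field.
  by rewrite ler_wpM2r // sqr_ge0.
have [k tk km] : exists2 k : nat, j n = k%:Z - (m n)%:Z & (k <= (m n).*2)%N.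
  by exists (absz (j n + (m n)%:Z)); lia.
rewrite (bin_stepE (c n) km tk).
have -> : c n k = b by move: k tk {km}; near: n.
have dk : `|k - m n|%N = `|j n|%N by lia.
rewrite bin_ratio_dist // dk.
have := bin_ratio_bounds jm; rewrite -/(x n).
have -> : (m n)%:R - x n + 1 = dl n * h n ^+ 2.
  by rewrite mh xy /dl /v; field.
have -> : (m n)%:R + x n = du n * h n ^+ 2.
  by rewrite mh xy /du /v; field.
rewrite xy exprMn.
have E d : y n ^+ 2 * h n ^+ 2 / (d * h n ^+ 2) = y n ^+ 2 / d.
  by rewrite -mulf_div divff ?mulr1 // expf_neq0.
rewrite !E; case: (b) => /=; first by rewrite !mul1r.
by rewrite !mul0r lexx.
Unshelve. all: by end_near. Qed.

(** Dominated convergence, with the factor [normal_peak 1] turning the pointwise limit into the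
    normal density cut off outside [B]. The bound of [bin_step_le] is a multiple of the density with
    standard deviation 2, hence integrable. *)
Lemma cvg_bin_window (c : nat -> pred nat) (B : set R) :
    measurable B ->
    {ae lebesgue_measure, forall t : R, \forall n \near \oo, forall k : nat,
       Num.floor (t * h n) = k%:Z - (m n)%:Z -> c n k = (t \in B)} ->
  (normal_peak 1 *
    ((\sum_(k < (m n).*2.+1 | c n k) bin_ratio (m n) k) / h n))%:E
    @[n --> \oo] --> normal_prob 0 1 B.
Proof.
move=> mB cB.
pose f n (t : R) : \bar R := (normal_peak 1 * bin_step (c n) (m n) t)%:E.
pose g (t : R) : \bar R := ((expR 1 * normal_peak 1 / normal_peak 2)%:E * (normal_pdf 0 2 t)%:E)%E.
have n10 : (1 : R) != 0 by rewrite oner_neq0.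
have n20 : (2 : R) != 0 by rewrite pnatr_eq0.
have p1 := normal_peak_gt0 n10; have p2 := normal_peak_gt0 n20.
have mstep n : measurable_fun setT (bin_step (c n) (m n)) by exact: measurable_bin_step.
have [] := @dominated_convergence _ _ R lebesgue_measure setT measurableT f
  ((fun t => (normal_pdf 0 1 t)%:E) \_ B) g.
- by move=> n; apply/measurable_EFinP; apply: measurable_funM => //; exact: mstep.
- apply/(measurable_restrictT _ mB) => //.
  apply: measurable_funTS; apply/measurable_EFinP; exact: measurable_normal_pdf.
- case: cB => N [mN N0 sN]; exists N; split => // t /= nt.
  apply: sN => /= cBt; apply: nt => _.
  have -> : ((fun t => (normal_pdf 0 1 t)%:E) \_ B) t =
      (normal_peak 1 * ((t \in B)%:R * normal_fun 0 1 t))%:E.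
    by rewrite patchE normal_pdfE //; case: ifP; rewrite ?mul1r ?mul0r ?mulr0.
  apply: cvg_EFin; first exact: nearW.
  by apply: cvgM; [exact: cvg_cst|exact: cvg_bin_step].
- by apply: integrableZl => //; exact: integrable_normal_pdf.
- apply/aeW => t n _; rewrite /f /g -EFinM abse_EFin lee_fin ger0_norm; last first.
    by rewrite mulr_ge0 ?normal_peak_ge0 ?bin_step_ge0.
  rewrite normal_pdfE // [leRHS](_ : _ = normal_peak 1 * (expR 1 * normal_fun 0 2 t)).
    by rewrite ler_wpM2l ?normal_peak_ge0 ?bin_step_le.
  by field; rewrite gt_eqF.
move=> _ _; rewrite -integral_mkcond; apply: cvg_trans.
apply: near_eq_cvg; apply: nearW => n /=.
rewrite /f; under eq_integral do rewrite EFinM.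
rewrite integralZl //; last by exact: integrable_bin_step.
by rewrite integral_bin_step // -EFinM.
Unshelve. all: by end_near. Qed.

Lemma de_moivre_laplace (z : nat -> R) (x : R) :
    (z n - (m n)%:R) / h n @[n --> \oo] --> x ->
  ((\sum_(k < (m n).*2.+1 | k%:R <= z n) 'C((m n).*2, k)%:R) / 2 ^+ (m n).*2)%:E
    @[n --> \oo] --> normal_prob 0 1 `]-oo, x]%classic.
Proof.
move=> zx.
have finN (B : set R) : measurable B -> normal_prob 0 1 B = (fine (normal_prob 0 1 B))%:E.
  by move=> mB; rewrite fineK // fin_num_measure.
have mx : measurable (`]-oo, x]%classic : set R) by exact: measurable_itv.
have A : (normal_peak 1 *
    ((\sum_(k < (m n).*2.+1 | k%:R <= z n) bin_ratio (m n) k) / h n))%:E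
    @[n --> \oo] --> normal_prob 0 1 `]-oo, x]%classic.
  apply: (@cvg_bin_window (fun n k => k%:R <= z n)) => //.
  (* For [t] other than the boundary point [x], the cell of [t] eventually lies on one side of the
     threshold. *)
  exists [set x]; split; [exact: measurable_set1|exact: lebesgue_measure_set1|].
  move=> t /=; apply: contra_notP => /eqP tx.
  have floorE n (k : nat) : Num.floor (t * h n) = k%:Z - (m n)%:Z ->
      (k%:R - (m n)%:R : R) <= t * h n < k%:R - (m n)%:R + 1.
    by move=> tk; have := floor_itv (t * h n); rewrite tk !intrD intrN.
  have [xt|xt|] := ltgtP t x; last by move/eqP; rewrite (negbTE tx).
    near=> n => k /floorE /andP[kt _].
    have : t < (z n - (m n)%:R) / h n by near: n; exact: (cvgr_gt _ zx).
    rewrite ltr_pdivlMr // => tz.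
    by rewrite mem_set /= ?in_itv /= ?(ltW xt) //; lra.
  near=> n => k /floorE /andP[_ kt].
  (* The floor only gives k - m > t h - 1, so a margin of one cell width is required to get k >
     z. *)
  have : (z n - (m n)%:R) / h n + (h n)^-1 < t.
    near: n; have : (z n - (m n)%:R) / h n + (h n)^-1 @[n --> \oo] --> x.
      by rewrite -[X in _ --> X]addr0; apply: cvgD => //; exact: cvg_inv_bin_scale.
    by move/cvgr_lt; apply.
  rewrite -[X in _ + X]mul1r -mulrDl ltr_pdivrMr // => tz.
  rewrite memNset /= ?in_itv /=; last by apply/negP; rewrite -ltNge.
  by apply/negbTE; rewrite -ltNge; lra.
have T : (normal_peak 1 *
    ((\sum_(k < (m n).*2.+1) bin_ratio (m n) k) / h n))%:E
    @[n --> \oo] --> normal_prob 0 1 (setT : set R).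
  apply: (@cvg_bin_window (fun _ => predT)) => //.
  by apply/aeW => t; apply: nearW => n k _; rewrite in_setT.
rewrite finN // in A *; rewrite finN // in T.
have [p1 p2] : 0 < normal_peak 1 :> R /\ (forall n, 0 < 'C((m n).*2, m n)%:R :> R).
  split; first by rewrite normal_peak_gt0 ?oner_neq0.
  by move=> n; rewrite ltr0n bin_gt0; lia.
have mass n : \sum_(k < (m n).*2.+1) 'C((m n).*2, k)%:R = 2 ^+ (m n).*2 :> R.
  rewrite -natr_sum -natrX; congr _%:R.
  by rewrite -[2%N]/(1 + 1)%N expnDn; apply: eq_bigr => k _; rewrite !exp1n !muln1.
apply: cvg_EFin; first exact: nearW.
move/fine_cvg in A; move/fine_cvg in T.
rewrite -[X in _ --> X]divr1.
have P1 : fine (normal_prob 0 1 (setT : set R)) = 1 by rewrite probability_setT.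
rewrite P1 in T.
(* In the quotient of the two windows [normal_peak 1], [h n] and the central coefficient cancel. *)
have := cvgM A (cvgV _ T); rewrite oner_neq0 => /(_ _ _ isT); apply: cvg_trans.
apply: near_eq_cvg; apply: nearW => n /=.
rewrite /= /unstable.inv_fun /= /bin_ratio -!big_distrl /= mass.
have h0 := h_gt0 n; have pn := p2 n.
by field; rewrite !gt_eqF ?exprn_gt0.
Unshelve. all: by end_near. Qed.

End step_limit.
End central_binomial.

(** * Counting coin sequences by their number of agreements *)

Section coin_counting.
Variable n : nat.
Implicit Types s u : {ffun 'I_n -> bool}.

(* Label 0 is a fictitious card that goes on top. *)
Definition coin_of_label s (i : nat) : bool :=
  if i is j.+1 then nth false [seq s k | k <- enum 'I_n] j else true.

Lemma coin_of_labelS s (i : 'I_n) : coin_of_label s i.+1 = s i.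
Proof. by rewrite /= (nth_map i) ?size_enum_ord // nth_ord_enum. Qed.

Definition agreement s : {ffun 'I_n -> bool} :=
  [ffun i : 'I_n => coin_of_label s i == coin_of_label s i.+1].

(** The coin of label 0 is fixed, and the coin of k with the agreement at k determines the coin of k
    + 1. So uniform coins have uniform agreements. *)
Lemma agreement_bij : bijective agreement.
Proof.
apply: injF_bij => s1 s2 /ffunP agr.
suff E k : (k <= n)%N -> coin_of_label s1 k = coin_of_label s2 k.
  by apply/ffunP => i; rewrite -!coin_of_labelS E.
elim: k => // k IH kn; have := agr (Ordinal kn); rewrite !ffunE.
have eqb_inj (a b c : bool) : (a == b) = (a == c) -> b = c by case: a b c => [] [] [].
by move=> agrk; apply: (eqb_inj (coin_of_label s2 k)); rewrite -{1}(IH (ltnW kn)).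
Qed.

Definition num_heads q u : nat := \sum_(i < n | (i < q)%N) u i.

Lemma num_heads_agreement q s : (q <= n)%N ->
  num_heads q (agreement s) = agreements (coin_of_label s) q.
Proof.
move=> qn; rewrite /agreements (big_ord_widen n (fun i =>
  (coin_of_label s i == coin_of_label s i.+1) : nat)) //.
by apply: eq_bigr => i _; rewrite ffunE.
Qed.

(* Compares coefficients in the expansion of (1 + X)^q 2^(n-q). *)
Lemma sum_num_heads_eq (R : realType) q k : (q <= n)%N ->
  \sum_u (num_heads q u == k)%:R = 'C(q, k)%:R * 2 ^+ (n - q) :> R.
Proof.
move=> qn.
have cardq : #|[pred i : 'I_n | (i < q)%N]| = q.
  by rewrite -sum1_card -(big_ord_widen n (fun _ => 1%N)) // sum1_card card_ord.
have cardNq : #|[predC [pred i : 'I_n | (i < q)%N]]| = (n - q)%N.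
  by apply: (@addnI q); rewrite subnKC // -{1}cardq cardC card_ord.
have gen : \sum_u 'X^(num_heads q u) = ((1 + 'X) ^+ q * 2%:R ^+ (n - q))%R :> {poly R}.
  (* Expanding the product chooses a side for every coin; coins from index [q] on contribute 1
     either way. *)
  transitivity (\prod_(i < n) \sum_(b : bool) (if (i < q)%N then 'X^b else 1 : {poly R})).
    rewrite bigA_distr_bigA; apply: eq_bigr => u _.
    by rewrite -big_mkcond -expr_sum.
  rewrite (bigID (fun i : 'I_n => (i < q)%N)) /=; congr (_ * _).
    rewrite (eq_bigr (fun _ => 1 + 'X)) => [|i iq]; last first.
      by rewrite big_bool iq /= addrC.
    rewrite -(big_ord_widen n (fun _ => 1 + 'X : {poly R})) //.
    by rewrite prodr_const card_ord.
  rewrite (eq_bigr (fun _ => 2%:R)) => [|i /negbTE iq]; last first.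
    by rewrite big_bool iq.
  rewrite prodr_const; congr (_ ^+ _).
  by rewrite -cardNq; apply: eq_card.
have := congr1 (fun p : {poly R} => p`_k) gen; rewrite coef_sum.
under eq_bigr do rewrite coefXn eq_sym.
move=> ->; rewrite -natrX -[X in _ * X]mulr_natr mul1r mulr_natr coefMn.
rewrite exprDn coef_sum.
under eq_bigr do rewrite expr1n mul1r coefMn coefXn eq_sym.
have [kq|kq] := ltnP k q.+1.
  rewrite (bigD1 (Ordinal kq)) //= eqxx big1 ?addr0 => [|i ik].
    by rewrite -natrX mulr_natr.
  by rewrite (_ : (_ == _) = false) ?mul0rn //; apply: contraNF ik.
rewrite big1 ?bin_small ?mul0r ?mul0rn // => i _.
by rewrite (_ : (_ == _) = false) ?mul0rn //; apply/negbTE; have := ltn_ord i; lia.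
Qed.

(** Reindexing along [agreement] turns agreements into heads; the remaining coins contribute 2^(n -
    q), which cancels. *)
Lemma count_agreements (R : realType) q (Q : pred nat) : (q <= n)%N ->
  #|[pred s | Q (agreements (coin_of_label s) q)]|%:R / 2 ^+ n =
  (\sum_(k < q.+1 | Q k) 'C(q, k)%:R) / 2 ^+ q :> R.
Proof.
move=> qn; rewrite -sum1_card natr_sum /=.
rewrite (eq_bigl (fun s => Q (num_heads q (agreement s)))); last first.
  by move=> s; rewrite inE num_heads_agreement.
rewrite -(reindex agreement (P := fun u => Q (num_heads q u)) (F := fun=> 1)) /=; last first.
  exact: onW_bij agreement_bij.
have heads_le u : (num_heads q u < q.+1)%N.
  rewrite ltnS /num_heads -[leqRHS]card_ord -sum1_card.
  rewrite (big_ord_widen n (fun _ => 1%N)) //.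
  by apply: leq_sum => i _; exact: leq_b1.
have -> : \sum_(u | Q (num_heads q u)) 1 =
    \sum_(k < q.+1 | Q k) \sum_u (num_heads q u == k)%:R :> R.
  rewrite exchange_big /= big_mkcond /=; apply: eq_bigr => u _.
  rewrite big_mkcond (bigD1 (Ordinal (heads_le u))) //= eqxx big1 ?addr0 // => i ik.
  case: ifP => // _; rewrite (_ : (_ == _) = false) //.
  by apply: contraNF ik => /eqP ik; apply/eqP/val_inj.
under [in LHS]eq_bigr do rewrite sum_num_heads_eq //.
rewrite -big_distrl /= -mulrA; congr (_ * _).
by rewrite -[in X in _ / X](subnK qn) exprD invfM mulrA divff ?mul1r // expf_neq0.
Qed.

End coin_counting.

(** Allows [q] to be the even one of p and p - 1: the extra coin term and at most one dropped
    agreement cost at most 2. *)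
Lemma double_correct_guesses_bounds p q (s : {ffun 'I_p.+1 -> bool}) :
    (0 < p)%N -> (q <= p <= q.+1)%N ->
  (p.+1 + agreements (coin_of_label s) q <=
    (correct_guesses p.+1 (shelf_shuffle s)).*2 <=
    p.+1 + agreements (coin_of_label s) q + 2)%N.
Proof.
move=> p0 qp.
rewrite (@correct_guesses_shelf p s (coin_of_label s)) //; last exact: coin_of_labelS.
move: (coin_of_label s) => t; have [->|->] : p = q \/ p = q.+1 by lia.
  by case: (t q); lia.
have -> : agreements t q.+1 = (agreements t q + (t q == t q.+1))%N by exact: big_ord_recr.
by case: (t q == _); case: (t q.+1); lia.
Qed.

(** * From counting to the distribution function of the score *)

Section coin_probability.
Context d (T : measurableType d) (R : realType) (P : probability T R).
Variables (n : nat) (C : 'I_n -> {RV P >-> bool}).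
Hypothesis C_fair : fair_coins C.

Let outcome (s : {ffun 'I_n -> bool}) : set T :=
  \bigcap_(i in [set` [set: 'I_n]%SET]) C i @^-1` [set s i].

Let measurable_coin i b : measurable (C i @^-1` [set b]).
Proof. by rewrite -[X in measurable X]setTI; exact: measurable_funP. Qed.

Let prob_coin i b : P (C i @^-1` [set b]) = (2^-1)%:E.
Proof.
case: b; first exact: C_fair.2.
rewrite (_ : _ @^-1` _ = ~` (C i @^-1` [set true])); last first.
  by apply/seteqP; split => w /=; case: (C i w).
rewrite probability_setC; last exact: measurable_coin.
by rewrite C_fair.2 -EFinB; congr _%:E; lra.
Qed.

Let prob_outcome s : P (outcome s) = (2^-1 ^+ n)%:E.
Proof.
rewrite /outcome (C_fair.1 [set: 'I_n]%SET (fun i => [set s i])) //.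
under eq_bigr do rewrite prob_coin.
rewrite prodEFin; congr _%:E.
by rewrite prodr_const cardsT card_ord.
Qed.

(** The event is a finite disjoint union of outcomes, each of probability 2^(-n) by independence. *)
Lemma prob_coins (A : pred {ffun 'I_n -> bool}) :
  P [set w | A [ffun i => C i w]] = (#|A|%:R / 2 ^+ n)%:E.
Proof.
have -> : [set w | A [ffun i => C i w]] = \bigcup_(s in [set` A]) outcome s.
  apply/seteqP; split => [w Aw|w [s As sw]] /=.
    by exists [ffun i => C i w] => // i _ /=; rewrite ffunE.
  rewrite (_ : finfun _ = s) //; apply/ffunP => i; rewrite ffunE.
  by apply: sw => /=; rewrite finset.inE.
rewrite measure_fin_bigcup //=; last 2 first.
- move=> s t _ _ [w [sw tw]]; apply/ffunP => i.
  by rewrite -(sw i) ?(tw i) //= finset.inE.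
- move=> s _; apply: fin_bigcap_measurable => [|i _]; first exact: finite_finset.
  exact: measurable_coin.
rewrite (fsbigE (enum A)) ?enum_uniq //; last 2 first.
- by move=> s /=; rewrite mem_enum.
- by move=> s /= As; rewrite mem_enum => /negP.
under eq_bigr do rewrite prob_outcome.
rewrite sumEFin (eq_bigl (mem (enum A))) => [|s]; last first.
  by rewrite [RHS]mem_enum; apply/idP/idP => [/set_mem //|sA]; exact: mem_set.
by rewrite -big_seq big_enum /= sumr_const exprVn [in RHS]mulrC mulr_natr.
Qed.

(** The standardized score is at most [x] iff 2 X - n <= z, and 2 X - n exceeds the number of
    agreements up to [q] by 0 to 2. *)
Lemma cdf_num_correct_bounds p q (x z : R) :
    n = p.+1 -> (0 < p)%N -> (q <= p <= q.+1)%N ->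
    z = n%:R / 2 + x * Num.sqrt n%:R / 2 ->
  (((\sum_(k < q.+1 | (k%:R <= z - 2)%R) 'C(q, k)%:R) / 2 ^+ q)%:E <=
   cdf (P := P) (standardize (num_correct R C) (3 / 4 * n%:R) (Num.sqrt n%:R / 4)) x <=
   ((\sum_(k < q.+1 | (k%:R <= z)%R) 'C(q, k)%:R) / 2 ^+ q)%:E)%E.
Proof.
move=> np p0 qp zE.
have qn : (q <= n)%N by lia.
have sn0 : 0 < Num.sqrt n%:R :> R by rewrite sqrtr_gt0 ltr0n np.
pose X (s : {ffun 'I_n -> bool}) : R := (correct_guesses n (shelf_shuffle s))%:R.
pose agr (s : {ffun 'I_n -> bool}) := agreements (coin_of_label s) q.
have X_agr s : (agr s)%:R + n%:R <= 2 * X s <= (agr s)%:R + n%:R + 2.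
  have : (n + agr s <= (correct_guesses n (shelf_shuffle s)).*2 <= n + agr s + 2)%N.
    rewrite /agr; move: s; rewrite np => s.
    exact: double_correct_guesses_bounds.
  by rewrite /X -addnn -!(ler_nat R) !natrD; lra.
have sE s : ((X s - 3 / 4 * n%:R) / (Num.sqrt n%:R / 4) <= x) = (2 * X s - n%:R <= z).
  rewrite ler_pdivrMr ?divr_gt0 // zE.
  by apply/idP/idP; lra.
pose A := [pred s : {ffun 'I_n -> bool} | 2 * X s - n%:R <= z].
have -> : cdf (P := P) (standardize (num_correct R C) (3 / 4 * n%:R) (Num.sqrt n%:R / 4)) x =
    (#|A|%:R / 2 ^+ n)%:E.
  rewrite -prob_coins; congr (P _); apply/seteqP.
  have ffunEC w : ([ffun i => C i w] : {ffun 'I_n -> bool}) = (fun i => C i w) :> ('I_n -> bool).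
    by apply/funext => i; rewrite ffunE.
  by split => w /=; rewrite in_itv /= /standardize /num_correct -sE /X ffunEC.
rewrite -(count_agreements R (fun k => k%:R <= z - 2) qn).
rewrite -(count_agreements R (fun k => k%:R <= z) qn).
rewrite !lee_fin !ler_pM2r ?invr_gt0 ?exprn_gt0 // !ler_nat.
apply/andP; split; apply: subset_leq_card; apply/fintype.subsetP => s;
  rewrite !inE /=; have /andP[] := X_agr s; rewrite /agr; lra.
Qed.

End coin_probability.

(** * Matching the scale of the score with that of the binomial, and the conclusion *)

Lemma cvg_succ_half : n./2.+1 @[n --> \oo] --> \oo.
Proof.
apply/cvgnyPge => A; near=> n.
have : (A.*2 <= n)%N by near: n; exact: nbhs_infty_ge.
lia.
Unshelve. all: by end_near. Qed.

Section clt_scaling.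
Variable R : realType.

Let m n := n./2.+1.

(** With v = 1 / h, w = (n + 3) / 2 - m in [0, 1] and u = sqrt (n + 3) / (2 h), the expression is x
    u + w v - e v, and u^2 = 1 + w v^2 / 2 tends to 1. *)
Lemma cvg_clt_threshold (x e : R) :
  ((n + 3)%:R / 2 + x * Num.sqrt (n + 3)%:R / 2 - e - (m n)%:R) / bin_scale R (m n)
    @[n --> \oo] --> x.
Proof.
pose v n := (bin_scale R (m n))^-1.
have h0 n : 0 < bin_scale R (m n) by exact: bin_scale_gt0.
have v0 : v n @[n --> \oo] --> 0 by apply: cvg_inv_bin_scale => //; exact: cvg_succ_half.
pose w n : R := (n + 3)%:R / 2 - (m n)%:R.
have w01 n : 0 <= w n <= 1.
  have : ((m n).*2 <= n + 3 <= (m n).*2 + 2)%N by rewrite /m; lia.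
  by rewrite -addnn -!(ler_nat R) /w !natrD; lra.
have wv0 : w n * v n @[n --> \oo] --> 0.
  apply: (squeeze_cvgr _ (cvg_cst 0) v0); apply: nearW => n.
  have /andP[w0 w1] := w01 n; have vn : 0 <= v n by rewrite invr_ge0 ltW.
  by rewrite mulr_ge0 //= ler_piMl.
pose u n := Num.sqrt (n + 3)%:R / 2 * v n.
have u2 n : u n ^+ 2 = 1 + w n * v n ^+ 2 / 2.
  rewrite /u !exprMn sqr_sqrtr // exprVn.
  have hE := sqr_bin_scale R (m n).
  have mE : (n + 3)%:R = 2 * (w n + (m n)%:R) by rewrite /w; lra.
  have mh : (m n)%:R = 2 * bin_scale R (m n) ^+ 2 by rewrite hE; lra.
  by rewrite mE mh /v; field; rewrite gt_eqF.
have u1 : u n @[n --> \oo] --> (1 : R).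
  have vv1 : 1 + v n * v n @[n --> \oo] --> (1 : R).
    rewrite -[X in _ --> X]addr0 -[X in 1 + X](mul0r 0).
    by apply: cvgD; [exact: cvg_cst|exact: cvgM].
  apply: (squeeze_cvgr _ (cvg_cst (1 : R)) vv1); apply: nearW => n.
  have /andP[w0 w1] := w01 n; have u2n := u2 n.
  have un : 0 <= u n by rewrite /u mulr_ge0 ?divr_ge0 ?sqrtr_ge0 ?invr_ge0 ?ltW.
  have vn : 0 <= v n ^+ 2 by rewrite sqr_ge0.
  have wv : 0 <= w n * v n ^+ 2 <= v n ^+ 2 by rewrite mulr_ge0 //= ler_piMl.
  (* This also yields the upper bound, through u <= u^2 <= 1 + v^2. *)
  have u1n : 1 <= u n by rewrite -(@ler_pXn2r _ 2) ?nnegrE ?ler01 // expr1n u2n; lra.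
  by rewrite u1n /= -expr2; nra.
rewrite (_ : (fun n => _) = fun n => x * u n + (w n * v n - e * v n)); last first.
  by apply/funext => n; rewrite /u /w /v; field; rewrite gt_eqF.
rewrite [X in _ --> X](_ : x = x * 1 + (0 - e * 0)); last by ring.
have xu : x * u n @[n --> \oo] --> x * 1 by apply: cvgM => //; exact: cvg_cst.
have ev : e * v n @[n --> \oo] --> e * 0 by apply: cvgM => //; exact: cvg_cst.
exact: cvgD xu (cvgB wv0 ev).
Qed.

End clt_scaling.

Theorem theorem5 (R : realType) (d : nat -> measure_display)
    (T : forall n, measurableType (d n)) (P : forall n, probability (T n) R)
    (C : forall n, 'I_n -> {RV (P n) >-> bool})
    (C_fair : forall n, fair_coins (C n)) :
  cvg_in_distribution P
    (fun n => standardize (num_correct R (C n))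
                (3 / 4 * n%:R) (Num.sqrt n%:R / 4))
    (normal_prob 0 1).
Proof.
(* With n + 3 cards there are n + 2 agreements, and half of that, rounded down, is [n./2.+1],
   positive for every [n]. *)
move=> x _; rewrite -(cvg_shiftn 3).
pose m n := n./2.+1.
have m_infty : m @ \oo --> \oo by exact: cvg_succ_half.
pose z n : R := (n + 3)%:R / 2 + x * Num.sqrt (n + 3)%:R / 2.
pose F e n : R := (\sum_(k < (m n).*2.+1 | k%:R <= z n - e) 'C((m n).*2, k)%:R) / 2 ^+ (m n).*2.
have FP e : (F e n)%:E @[n --> \oo] --> normal_prob 0 1 `]-oo, x]%classic.
  by apply: de_moivre_laplace => //; exact: cvg_clt_threshold.
(* The shift 2 between the bounds disappears after division by the scale, so both have the same
   limit. *)
apply: (squeeze_cvge _ (FP 2) (FP 0)); apply: nearW => n.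
rewrite /F subr0.
by apply: (@cdf_num_correct_bounds _ _ _ _ _ _ (C_fair (n + 3)%N) (n + 2)%N); rewrite /m //; lia.
Qed.
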